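(* Let $k\ge1$, $\lambda\in\mathrm{Par}^k$, let $\kappa=\mathfrak p^{-1}(\lambda)$, and let $\kappa/\eta$ be the $k$-skew diagram of $\lambda$. Regarding $\lambda$ as an element of $\mathbb Z^{\ell(\kappa)}$, we have $$H(\Delta^k(\lambda);\lambda)=H(\Phi(\kappa/\eta);\lambda).$$
   Context: For $\gamma\in\mathbb Z^\ell$, $s_\gamma=\det(h_{\gamma_i+j-i})_{1\le i,j\le\ell}$ ($h_0=1$, $h_d=0$ for $d<0$). $\Delta^+_\ell=\{(i,j):1\le i<j\le\ell\}$. For $\Psi\subset\Delta^+_\ell$ and $\gamma\in\mathbb Z^\ell$, the Catalan function $H(\Psi;\gamma)=\prod_{(i,j)\in\Psi}(1-tR_{ij})^{-1}s_\gamma$ is obtained by expanding $\prod_{(i,j)\in\Psi}(1-tz_i/z_j)^{-1}z^\gamma$ as a power series in $t$ and applying coefficientwise the linear map $z^\beta\mapsto s_\beta$. $\mathrm{Par}^k$ is the set of partitions with largest part $\le k$; $\ell(\cdot)$ denotes the number of nonzero parts. For $\lambda\in\mathbb Z^\ell$, $\Delta^k(\lambda)=\{(i,j)\in\Delta^+_\ell:k-\lambda_i+i<j\}$. Hook length of a box (English notation): number of boxes below it in its column plus those weakly to its right in its row. A $(k+1)$-core is a partition with no box of hook length $k+1$; $\mathfrak p(\kappa)$ has $r$-th part equal to the number of boxes in row $r$ of $\kappa$ with hook length $\le k$, a bijection from $(k+1)$-cores to $\mathrm{Par}^k$. The $k$-skew diagram of $\lambda$ is the subdiagram of $\kappa=\mathfrak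 p^{-1}(\lambda)$ consisting of the boxes with hook length $\le k$; it is a skew shape $\kappa/\eta$ with $\eta$ a partition, whose row lengths are $\lambda$. Let $\mu_c$ be the number of boxes in column $c$ of $\kappa/\eta$. Then $\Phi(\kappa/\eta)=\{(i,j)\in\Delta^+_{\ell(\kappa)}: i\le\ell(\eta)\text{ and } j\ge\mu_{\eta_i}+i\}$. *)

(* Defs.v *)
From HB Require Import structures.
From mathcomp Require Import all_boot all_order all_algebra.
From mathcomp Require Import finmap.
From mathcomp Require Import monalg.

Set Implicit Arguments.
Unset Strict Implicit.
Unset Printing Implicit Defensive.

Import Order.TTheory GRing.Theory Num.Theory.

(* All indices are 0-based: row r, column c and index i stand for r+1, c+1,   *)
(* i+1 in the usual 1-based notation.                                         *)

Section SymmetricFunctions.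

Local Open Scope ring_scope.

(* Symmetric functions in infinitely many variables, as the polynomial ring   *)
(* Z[h_1, h_2, ...]; the monomial generator of index n is h_(n+1).            *)
Definition symfun := {malg int[{cmonom nat}]}.

Definition h (d : int) : symfun :=
  match d with
  | Posz 0 => 1
  | Posz n.+1 => << ucm n >>
  | Negz _ => 0
  end.

Definition schur (l : nat) (gamma : 'rV[int]_l) : symfun :=
  \det (\matrix_(i < l, j < l) h (gamma 0 i + j%:Z - i%:Z)).

Definition Delta_plus (l : nat) : {set 'I_l * 'I_l} :=
  [set p : 'I_l * 'I_l | (p.1 < p.2)%N].

(* The power series H(Psi; gamma) in t, given by its coefficients: each       *)
(* factor expands as sum_n t^n (z_i / z_j)^n, so the coefficient of t^d in    *)
(* prod_((i, j) in Psi) (1 - t z_i / z_j)^-1 z^gamma is the sum, over the     *)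
(* choices m of an exponent for each element of Psi with total exponent d, of *)
(* the monomials z^(gamma + sum_((i, j) in Psi) m_ij (e_i - e_j)).            *)
Definition catalan (l : nat) (Psi : {set 'I_l * 'I_l}) (gamma : 'rV[int]_l)
    (d : nat) : symfun :=
  \sum_(m : {ffun 'I_l * 'I_l -> 'I_d.+1} |
          (ord0.-support m \subset Psi) && (\sum_(p in Psi) m p == d)%N)
    schur (gamma
           + \sum_(p in Psi) (delta_mx 0 p.1 - delta_mx 0 p.2) *+ m p).

Definition Delta_k (k l : nat) (lambda : 'rV[int]_l) : {set 'I_l * 'I_l} :=
  [set p in Delta_plus l | k%:Z - lambda 0 p.1 + p.1%:Z < p.2%:Z].

Definition weight (l : nat) (lambda : seq nat) : 'rV[int]_l :=
  \row_(i < l) (nth 0%N lambda i)%:Z.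

End SymmetricFunctions.

Definition is_part (s : seq nat) : bool := sorted geq s && (0 \notin s).

Definition Par (k : nat) (s : seq nat) : bool := is_part s && all (geq k) s.

Definition box (s : seq nat) (r c : nat) : bool := c < nth 0 s r.

(* The first summand counts the boxes strictly below (r, c) in column c, the  *)
(* second one the boxes weakly to the right of (r, c) in row r.               *)
Definition hook (s : seq nat) (r c : nat) : nat :=
  count (fun r' => box s r' c) (iota r.+1 (size s - r.+1)) + (nth 0 s r - c).

Definition is_core (n : nat) (s : seq nat) : Prop :=
  is_part s /\ forall r c, box s r c -> hook s r c <> n.

Definition bounded_part (k : nat) (kappa : seq nat) : seq nat :=
  [seq count (fun c => hook kappa r c <= k) (iota 0 (nth 0 kappa r))
     | r <- iota 0 (size kappa)].

Definition skew_box (kappa eta : seq nat) (r c : nat) : bool :=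
  box kappa r c && ~~ box eta r c.

Definition is_k_skew (k : nat) (kappa eta : seq nat) : Prop :=
  [/\ is_part eta,
      forall r c, box eta r c -> box kappa r c
    & forall r c, skew_box kappa eta r c = box kappa r c && (hook kappa r c <= k)].

Definition col_size (kappa eta : seq nat) (c : nat) : nat :=
  count (fun r => skew_box kappa eta r c) (iota 0 (size kappa)).

(* Column eta_i in 1-based numbering is column eta_i - 1 here; eta_i is       *)
(* nonzero for the rows i below the length of eta.                            *)
Definition Phi (kappa eta : seq nat) :
    {set 'I_(size kappa) * 'I_(size kappa)} :=
  [set p in Delta_plus (size kappa) |
     (p.1 < size eta) && (col_size kappa eta (nth 0 eta p.1).-1 + p.1 <= p.2)].

(* Main.v *)
Require Import Defs.
From mathcomp Require Import all_boot all_order all_algebra.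
From mathcomp Require Import perm finmap monalg zify.

Set Implicit Arguments.
Unset Strict Implicit.
Unset Printing Implicit Defensive.

Import Order.TTheory GRing.Theory Num.Theory.

(* Write d(i) = k - lambda_i + i + 1 for the column where row i of            *)
(* Delta^k(lambda) starts.  The core satisfies eta_i = kappa_(d(i)), and      *)
(* Phi(kappa/eta) has row starts phi(i) >= d(i) with                          *)
(* kappa_(phi(i)) = eta_i, so all columns between d(i) and phi(i) index rows  *)
(* of kappa of equal length.  Pass from Delta^k to Phi by removing roots one  *)
(* at a time, treating the rows from bottom to top.  Removing beta = (i, j)   *)
(* costs t H(Psi; lambda + eps_beta), where Psi has equal columns j and j+1   *)
(* and the weight satisfies gamma_j + 1 = gamma_(j+1).  This vanishes by a    *)
(* mirror argument: rows j and j+1 start at consecutive columns phi(j) and    *)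
(* phi(j)+1, the rows indexed by these are again of equal length, and so on   *)
(* down to rows without roots, where antisymmetry of s_gamma applies.         *)

(** Two facts about Catalan functions suffice. And H(Psi; gamma) = 0 if Psi is stable under
    exchanging the indices y and y+1 and gamma_y + 1 = gamma_(y+1), since s_gamma is alternating
    ([catalan_sym0]). [catalan_mirror] extends this vanishing to root sets that are symmetric only
    up to a chain of consecutive rows.

    The core enters through kappa_i = lambda_i + eta_i: two rows of kappa of equal length agree in
    both lambda and eta. Agreement in lambda gives the defect in the weight of each cost term;
    agreement in eta makes the starts phi of adjacent rows consecutive, which is what the chain
    requires. The facts on hooks behind this are [core_bounce] and [skew_start_spec]. *)

Section Catalan.
Local Open Scope ring_scope.
Variable l : nat.
Implicit Types (Psi : {set 'I_l * 'I_l}) (p q : 'I_l * 'I_l) (gamma : 'rV[int]_l).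

(** * Root removal and antisymmetry *)

Definition root_vec p : 'rV[int]_l := delta_mx 0 p.1 - delta_mx 0 p.2.

Lemma supportP Psi d (m : {ffun 'I_l * 'I_l -> 'I_d.+1}) :
  reflect (forall q, q \notin Psi -> m q = 0%N :> nat) (ord0.-support m \subset Psi).
Proof.
apply: (iffP subsetP) => [sub q qPsi | m0 q].
  by apply: contraNeq qPsi => mq; apply: sub; rewrite inE -val_eqE.
by rewrite inE -val_eqE /=; apply: contraR => /m0 ->.
Qed.

(** Coefficientwise form of (1 - tx)^-1 = 1 + tx (1 - tx)^-1: split by whether the exponent of [p]
    vanishes, and lower it by one if it does not. *)
Lemma catalan_remove Psi p gamma d : p \in Psi ->
  catalan Psi gamma d = catalan (Psi :\ p) gamma d +
    (if d is d'.+1 then catalan Psi (gamma + root_vec p) d' else 0).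
Proof.
move=> pPsi; rewrite {1}/catalan.
rewrite (bigID (fun m : {ffun 'I_l * 'I_l -> 'I_d.+1} => m p == ord0)).
apply: f_equal2.
  apply: eq_big => [m | m /andP[_ /eqP mp0]].
    rewrite (big_setD1 p) //= -andbA andbC -andbA [in RHS]andbC.
    case: (m p =P ord0) => [mp|mp]; last first.
      rewrite andbF; apply/esym/negP => /andP[_ /supportP/(_ p)].
      by rewrite !inE eqxx => /(_ isT) mp0; apply: mp; apply: val_inj.
    rewrite mp add0n andTb; apply: f_equal2 => //.
    apply/supportP/supportP => m0 q; last by move=> qP; apply: m0; rewrite !inE (negPf qP) andbF.
    rewrite !inE negb_and negbK; case: eqP => [->|_] /=; [by rewrite mp | exact: m0].
  apply: (f_equal (fun v => schur (gamma + v))).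
  by rewrite (big_setD1 p) //= mp0 mulr0n add0r.
case: d => [|d].
  by rewrite big1 // => m; rewrite [m p]ord1 eqxx andbF.
pose up (m : {ffun 'I_l * 'I_l -> 'I_d.+1}) : {ffun 'I_l * 'I_l -> 'I_d.+2} :=
  [ffun q => inord (m q + (q == p))].
pose dn (m : {ffun 'I_l * 'I_l -> 'I_d.+2}) : {ffun 'I_l * 'I_l -> 'I_d.+1} :=
  [ffun q => inord (m q - (q == p))].
have upE m q : up m q = (m q + (q == p))%N :> nat.
  by rewrite ffunE inordK //; case: (q == p); have := ltn_ord (m q); lia.
have upK : cancel up dn.
  by move=> m; apply/ffunP => q; apply: val_inj; rewrite ffunE upE addnK /= inordK.
have dnK (m : {ffun 'I_l * 'I_l -> 'I_d.+2}) :
    (forall q, q \notin Psi -> m q = 0%N :> nat) ->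
    (\sum_(q in Psi) m q = d.+1)%N -> m p != ord0 -> up (dn m) = m.
  move=> m0 sm; rewrite -val_eqE -lt0n /= => mp.
  apply/ffunP => q; apply: val_inj; rewrite [LHS]upE ffunE.
  (* [inord] loses nothing: the total is d+1 and [p] takes at least one, so any other exponent is at
     most d. *)
  suff mq : (m q - (q == p) <= d)%N.
    by rewrite inordK // subnK //; case: eqP => // ->.
  case: eqP => [_|/eqP qp]; first by have := ltn_ord (m q); lia.
  case: (boolP (q \in Psi)) => [qP|/m0 ->//].
  have qP' : q \in Psi :\ p by rewrite !inE qp.
  by move: sm; rewrite (big_setD1 p) //= (big_setD1 q) //=; lia.
have up_neq0 m : up m p != ord0.
  by apply/eqP => /(congr1 (@nat_of_ord _)); rewrite upE eqxx addn1.
have up_supp m : (ord0.-support (up m) \subset Psi) = (ord0.-support m \subset Psi).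
  apply/supportP/supportP => m0 q qP; have := m0 q qP; rewrite upE; first lia.
  by move=> ->; case: eqP qP => // ->; rewrite pPsi.
have up_sum m : (\sum_(q in Psi) up m q = (\sum_(q in Psi) m q).+1)%N.
  rewrite (eq_bigr (fun q => m q + (q == p))%N) => [|q _]; last exact: upE.
  rewrite big_split /= [X in (_ + X)%N](big_setD1 p) //= eqxx [X in (_ + (_ + X))%N]big1 ?addn1 //.
  by move=> q; rewrite !inE => /andP[/negPf->].
have up_vec m : \sum_(q in Psi) root_vec q *+ up m q
    = root_vec p + \sum_(q in Psi) root_vec q *+ m q.
  rewrite (eq_bigr (fun q => root_vec q *+ m q + root_vec q *+ (q == p))) => [|q _].
    rewrite big_split /= addrC; apply: f_equal2 => //.
    rewrite (big_setD1 p) //= eqxx big1 ?addr0 //.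
    by move=> q; rewrite !inE => /andP[/negPf->].
  by rewrite upE mulrnDr.
rewrite (reindex_onto up dn); last first.
  by move=> m /andP[/andP[/supportP m0 /eqP sm] mp0]; exact: dnK.
rewrite [RHS]/catalan; apply: eq_big => [m | m _].
  by rewrite up_neq0 upK eqxx up_supp up_sum !andbT.
by rewrite -addrA -up_vec.
Qed.

Lemma symfun_eq_opp (x : symfun) : x = - x -> x = 0.
Proof.
move=> xN; apply/malgP => u; rewrite mcoeff0.
by have := congr1 (mcoeff u) xN; rewrite mcoeffN; lia.
Qed.

(** Exchange of two adjacent rows of the Jacobi-Trudi determinant. *)
Lemma schur_straighten (y z : 'I_l) gamma gamma' : z = y.+1 :> nat ->
  gamma' 0 y = gamma 0 z - 1 -> gamma' 0 z = gamma 0 y + 1 ->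
  (forall i, i != y -> i != z -> gamma' 0 i = gamma 0 i) ->
  schur gamma' = - schur gamma.
Proof.
move=> zy gy gz gE; rewrite /schur.
have yz : y != z by rewrite -val_eqE /= zy; lia.
set A := (X in _ = - \det X).
set B := (X in \det X = _).
have -> : B = xrow y z A.
  apply/matrixP => i j; rewrite !mxE; case: tpermP => [->|->|/eqP iy /eqP iz].
  - by congr h; rewrite gy zy; lia.
  - by congr h; rewrite gz zy; lia.
  - by rewrite gE.
by rewrite xrowE det_mulmx det_perm odd_tperm yz expr1 mulN1r.
Qed.

(** Permuting the exponents by the transposition pairs each Schur term with its negative, so the sum
    equals its own opposite. *)
Lemma catalan_sym0 (y z : 'I_l) Psi gamma d : z = y.+1 :> nat ->
  (forall i j, ((tperm y z i, tperm y z j) \in Psi) = ((i, j) \in Psi)) ->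
  gamma 0 y + 1 = gamma 0 z -> catalan Psi gamma d = 0.
Proof.
move=> zy sym gyz; apply: symfun_eq_opp.
pose s (p : 'I_l * 'I_l) := (tperm y z p.1, tperm y z p.2).
have sK : involutive s by move=> [i j]; rewrite /s /= !tpermK.
have sP p : (s p \in Psi) = (p \in Psi) by case: p => i j; exact: sym.
pose r (m : {ffun 'I_l * 'I_l -> 'I_d.+1}) : {ffun 'I_l * 'I_l -> 'I_d.+1} :=
  [ffun q => m (s q)].
have rK : involutive r by move=> m; apply/ffunP => q; rewrite !ffunE sK.
have yz : y != z by rewrite -val_eqE /= zy; lia.
rewrite {1}/catalan (reindex_inj (inv_inj rK)) /= -sumrN; apply: eq_big => m.
  congr andb.
    by apply/supportP/supportP => m0 q qP; have := m0 (s q); rewrite ?ffunE ?sK sP; apply.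
  rewrite (reindex_inj (inv_inj sK)) /=; congr (_ == _).
  by apply: eq_big => q; rewrite ?sP // ffunE sK.
move=> _.
have -> : \sum_(p in Psi) (delta_mx 0 p.1 - delta_mx 0 p.2) *+ r m p
  = \sum_(p in Psi) (delta_mx 0 (tperm y z p.1) - delta_mx 0 (tperm y z p.2)) *+ m p
    :> 'rV[int]_l.
  rewrite (reindex_inj (inv_inj sK)) /=.
  by apply: eq_big => q; rewrite ?sP // ffunE sK.
set S' := \sum_(p in Psi) (delta_mx 0 (tperm y z p.1) - _) *+ _.
set S := \sum_(p in Psi) (delta_mx 0 p.1 - _) *+ _.
have coord i : S' 0 i = S 0 (tperm y z i).
  rewrite /S /S' !summxE; apply: eq_bigr => p _; rewrite !mulmxnE !mxE /=.
  by rewrite !(canF_eq (tpermK y z)).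
have addE (u v : 'rV[int]_l) i : (u + v) 0 i = u 0 i + v 0 i by rewrite mxE.
apply: (schur_straighten zy); rewrite ?addE ?coord ?tpermL ?tpermR -?gyz.
- by rewrite [RHS]addrAC addrK.
- by rewrite addrAC.
by move=> i iy iz; rewrite !addE coord tpermD // eq_sym.
Qed.

End Catalan.

(** * The mirror argument for root sets given by row starts *)

Section Mirror.
Local Open Scope ring_scope.
Variable l : nat.
Implicit Types (f : nat -> nat) (gamma : 'rV[int]_l).

(** A start at or beyond [l] encodes an empty row. *)
Definition row_roots f : {set 'I_l * 'I_l} := [set p : 'I_l * 'I_l | (f p.1 <= p.2)%N].

Lemma add_root_vecE gamma (p : 'I_l * 'I_l) x :
  (gamma + root_vec p) 0 x = gamma 0 x + ((x == p.1)%:R - (x == p.2)%:R).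
Proof. by rewrite !mxE. Qed.

Lemma catalan_row_remove f (i j : 'I_l) gamma d : f i = j ->
  catalan (row_roots f) gamma d
  = catalan (row_roots [eta f with nat_of_ord i |-> j.+1]) gamma d +
    (if d is d'.+1 then catalan (row_roots f) (gamma + root_vec (i, j)) d' else 0).
Proof.
move=> fi; have ij : (i, j) \in row_roots f by rewrite inE /= fi.
have <- : row_roots f :\ (i, j) = row_roots [eta f with nat_of_ord i |-> j.+1].
  apply/setP => -[a b]; rewrite !inE /= xpair_eqE -!val_eqE /=.
  by case: eqP => [->|_] //=; rewrite fi; lia.
exact: catalan_remove.
Qed.

(** Columns [y] and [z] differ exactly in the rows that start at [z]. *)
Lemma catalan_row_sym0 f (y z : 'I_l) gamma d : z = y.+1 :> nat ->
  (z < f y)%N -> (forall c : 'I_l, (f y <= c) = (f z <= c))%N ->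
  (forall r : 'I_l, r != y -> r != z -> f r <> z) ->
  gamma 0 y + 1 = gamma 0 z -> catalan (row_roots f) gamma d = 0.
Proof.
move=> zy zf fyz fr; apply: (catalan_sym0 d zy) => i j; rewrite !inE /=.
have colE c : (f y <= tperm y z c)%N = (f y <= c)%N.
  by case: tpermP => [->|->|] //; lia.
case: tpermP => [->|->|/eqP iy /eqP iz]; rewrite -?fyz ?colE //.
by have := fr i iy iz; case: tpermP => [->|->|] //; lia.
Qed.

(* Rows [a, b] of a chain of mirrors point to the next rows [u, v] of it; the
   last ones carry no roots.  Exchanging the roots [(y, u)] and [(z, u)] moves
   the defect [gamma_y + 1 = gamma_z] from the rows [y, z] down to [u, v]. *)
Lemma catalan_mirror (kap f : nat -> nat) (y z : 'I_l) gamma d :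
  z = y.+1 :> nat -> kap y = kap z -> gamma 0 y + 1 = gamma 0 z ->
  (forall r : 'I_l, f r <> z) ->
  (forall a b : 'I_l, b = a.+1 :> nat -> (y <= a)%N -> kap a = kap b ->
    [/\ (b < f a)%N, (b < f b)%N, a != y -> gamma 0 a = gamma 0 b &
      (l <= f a /\ l <= f b)%N \/
      exists u v : 'I_l, [/\ f a = u, f b = v, v = u.+1 :> nat, kap u = kap v
                         & forall r : 'I_l, f r = v -> r = b]]) ->
  catalan (row_roots f) gamma d = 0.
Proof.
have [n] := ubnP (l - y); elim: n => // n IHn in f y z gamma d *.
move=> ly zy kyz gyz ceil chain.
have [zfy zfz _ [[lfy lfz] | [u [v [fy fz vu kuv fv]]]]] := chain y z zy (leqnn _) kyz.
  apply: (catalan_row_sym0 d zy zfy _ _ gyz) => [c|r _ _]; last exact: ceil.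
  by have := ltn_ord c; lia.
have vy : (z < u)%N by rewrite -fy.
have [yu zu yv zv] : [/\ y != u, z != u, y != v & z != v].
  by split; rewrite -val_eqE /=; lia.
have yz : y != z by rewrite -val_eqE /=; lia.
have uv : u != v by rewrite -val_eqE /=; lia.
(* Without (y, u), rows [y] and [z] both start at [v], so only the cost term survives. *)
rewrite (catalan_row_remove gamma d fy).
rewrite (catalan_row_sym0 (y := y) (z := z)) ?add0r //=; first last.
- by move=> r ry rz; rewrite -val_eqE /= in ry; rewrite (negPf ry); exact: ceil.
- by move=> c; rewrite eqxx fz -vu; have -> : (z == y :> nat) = false by lia.
- by rewrite eqxx; lia.
case: d => // d.
set g1 := gamma + root_vec (y, u).
have g1E x : g1 0 x = gamma 0 x + ((x == y)%:R - (x == u)%:R) by exact: add_root_vecE.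
(* Adding (z, u) frees column [v] of starts, so induction at (u, v) kills [f1] with weight [g1];
   removing it again costs a term in which rows [y] and [z] both start at [u]. *)
pose f1 := [eta f with nat_of_ord z |-> nat_of_ord u].
have f1z : f1 z = u by rewrite /f1 /= eqxx.
have f1n r : r != nat_of_ord z -> f1 r = f r by move=> /negPf rz; rewrite /f1 /= rz.
have f1y : f1 y = u by rewrite f1n ?fy //; lia.
have f1f : row_roots [eta f1 with nat_of_ord z |-> u.+1] = row_roots f.
  apply/setP => -[a b]; rewrite !inE /=; case: eqP => [->|//].
  by rewrite fz vu.
have := catalan_row_remove g1 d f1z; rewrite f1f.
have -> : catalan (row_roots f1) g1 d = 0.
  apply: (IHn f1 u v) => //; first by have := ltn_ord u; lia.
  - have [_ _ guv _] := chain u v vu ltac:(lia) kuv.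
    rewrite !g1E eqxx [v == u]eq_sym !(negPf uv) [u == y]eq_sym [v == y]eq_sym.
    by rewrite (negPf yu) (negPf yv) guv 1?eq_sym // !add0r oppr0 addr0 subrK.
  - move=> r; case: (r =P z) => [->|/eqP rz]; first by rewrite f1z; lia.
    by rewrite f1n // => /fv; apply/eqP.
  move=> a b ba ua kab.
  have [bfa bfb gab cab] := chain a b ba ltac:(lia) kab.
  rewrite !f1n; try lia; split=> //.
    move=> au; have [ay byn bu] : [/\ a != y, b != y & b != u].
      by split; rewrite -val_eqE /=; lia.
    by rewrite !g1E gab // (negPf au) (negPf ay) (negPf byn) (negPf bu).
  case: cab => [|[u' [v' [fa fb vu' kuv' fv']]]]; [by left | right].
  exists u', v'; split=> // r; case: (r =P z) => [->|/eqP rz]; last by rewrite f1n //; exact: fv'.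
  by rewrite f1z; lia.
case: d => [|d] => [/esym|]; first by rewrite addr0.
rewrite (catalan_row_sym0 (f := f1) (y := y) (z := z)) ?addr0 //.
- by rewrite f1y.
- by move=> c; rewrite f1y f1z.
- by move=> r _ rz; rewrite f1n //; exact: ceil.
rewrite !add_root_vecE /= !eqxx [z == y]eq_sym.
by rewrite (negPf yz) (negPf yu) (negPf zu) -gyz /= ?subr0 ?addr0.
Qed.

End Mirror.

(** * Raising the row starts from d to phi *)

Lemma eq_row_roots l (f g : nat -> nat) :
  (forall i c, i < l -> c < l -> (f i <= c) = (g i <= c)) ->
  row_roots l f = row_roots l g.
Proof. by move=> fg; apply/setP => -[i c]; rewrite !inE fg. Qed.

Lemma eq_catalan_row l (f g : nat -> nat) gamma e :
  (forall i c, i < l -> c < l -> (f i <= c) = (g i <= c)) ->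
  catalan (row_roots l f) gamma e = catalan (row_roots l g) gamma e.
Proof. by move=> /eq_row_roots ->. Qed.

Lemma eq_of_steps (T : Type) (C : nat -> T) a b : a <= b ->
  (forall j, a <= j < b -> C j = C j.+1) -> C a = C b.
Proof.
move=> ab stepC; rewrite -(subnKC ab); move: (leqnn (b - a)).
elim: {1 3}(b - a) => [|n IHn] nb; first by rewrite addn0.
by rewrite IHn ?(ltnW nb) // addnS stepC //; lia.
Qed.

Section RaisingRows.
Variables (l : nat) (kap lam eta d phi : nat -> nat) (gamma : 'rV[int]_l).
Hypotheses (lam_anti : {homo lam : i j / i <= j >-> j <= i})
  (eta_anti : {homo eta : i j / i <= j >-> j <= i})
  (kapE : forall i, kap i = lam i + eta i)
  (lam_gt0 : forall i, (0 < lam i) = (i < l))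
  (kap_gt0 : forall i, (0 < kap i) = (i < l)).
Hypotheses (d_gt : forall i, i < d i) (d_mono : {homo d : i j / i < j})
  (kap_d : forall i, kap (d i) = eta i).
Hypotheses (d_phi : forall i, d i <= phi i) (kap_phi : forall i, kap (phi i) = eta i)
  (phi_mono : {homo phi : i j / i < j})
  (phiS : forall i, 0 < eta i -> eta i.+1 = eta i -> phi i.+1 = (phi i).+1).
Hypothesis gammaE : forall i, (gamma 0 i = (lam i)%:Z)%R.

Let kap_anti : {homo kap : i j / i <= j >-> j <= i}.
Proof. by move=> i j ij; rewrite !kapE leq_add ?lam_anti ?eta_anti. Qed.

(** Rows are raised from the bottom up, so that the mirror chain, which lives strictly below the
    current row, only meets starts [phi]. *)
Let partial (n : nat) : nat -> nat := fun r => if r < n then d r else phi r.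

Let partialT n r : n <= r -> partial n r = phi r.
Proof. by rewrite /partial ltnNge => ->. Qed.

Lemma catalan_raised_root i (i' j : 'I_l) e : i' = i :> nat -> d i <= j < phi i ->
  catalan (row_roots l [eta partial i with i |-> nat_of_ord j])
    (gamma + root_vec (i', j))%R e = 0%R.
Proof.
move=> i'E /andP[dj jphi]; set f := [eta _ with _ |-> _].
have il : i < l by rewrite -i'E.
have fE r : f r = if r == i then nat_of_ord j else if r < i then d r else phi r by [].
have flt r : r < i -> f r = d r by move=> ri; rewrite fE ri ltn_eqF.
have fgt r : i < r -> f r = phi r.
  by move=> ir; rewrite fE gtn_eqF // ltnNge (ltnW ir).
have fi : f i = j by rewrite fE eqxx.
have f_below r : r <= i -> f r <= j.
  by rewrite leq_eqVlt => /orP[/eqP ->|ri]; rewrite ?fi // flt // (leq_trans _ dj) // ltnW ?d_mono.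
have kapj c : d i <= c <= phi i -> kap c = eta i.
  case/andP => dc cp; apply/eqP; rewrite eqn_leq.
  by rewrite -{1}(kap_d i) kap_anti //= -(kap_phi i) kap_anti.
have eta0 : 0 < eta i by rewrite -(kapj j) ?kap_gt0 // dj ltnW.
have jl : j.+1 < l by rewrite -kap_gt0 kapj // jphi (leq_trans dj) // leqnSn.
have ij : i < j by apply: leq_trans dj.
pose z : 'I_l := Ordinal jl.
have eta_eq a : kap a = kap a.+1 -> eta a.+1 = eta a /\ lam a.+1 = lam a.
  have := lam_anti (leqnSn a); have := eta_anti (leqnSn a); rewrite !kapE; lia.
have kjz : kap j = kap z by rewrite !kapj ?jphi ?(leq_trans dj) ?(ltnW jphi) ?leqnSn ?dj.
apply: (catalan_mirror (kap := kap) (y := j) (z := z)) => //.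
- have [_ lj] := eta_eq _ kjz.
  rewrite !add_root_vecE /= !gammaE -!val_eqE /= i'E eqxx lj.
  by rewrite !gtn_eqF ?ltnS ?(ltnW ij) //= add0r !subrK ?subr0 ?addr0.
- move=> r; have -> : z = j.+1 :> nat by []; case: (leqP r i) => [/f_below|ir]; first lia.
  by rewrite fgt //; have := phi_mono ir; lia.
move=> a b ba ja kab; rewrite ba in kab.
have ia : i < a by apply: leq_trans ja.
have ib : i < b by lia.
have [ea la] := eta_eq _ kab.
have laml : 0 < lam b by rewrite lam_gt0.
(* Otherwise kap b <= kap (phi a) = eta a = eta b, against lam b > 0. *)
have b_phi : b < phi a.
  rewrite ltnNge; apply/negP => /kap_anti; rewrite kap_phi kapE.
  by rewrite {2}ba ea leqNgt -{1}[eta a]add0n ltn_add2r laml.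
rewrite !fgt //; split=> //.
- by apply: leq_trans (d_phi b).
- rewrite -val_eqE /= => aj; have ja' : j < a by rewrite ltn_neqAle eq_sym aj.
  rewrite !add_root_vecE /= !gammaE -!val_eqE /= i'E ba la.
  by rewrite !gtn_eqF // ltnS ltnW.
case: (posnP (eta a)) => [ea0 | ea0].
  have l_phi r : eta r = 0 -> l <= phi r by move=> er; rewrite leqNgt -kap_gt0 kap_phi er.
  by left; rewrite !l_phi // ba ea.
have phib : phi b = (phi a).+1 by rewrite ba phiS.
have kb : kap (phi b) = eta a by rewrite kap_phi ba.
have lb : phi b < l by rewrite -kap_gt0 kb.
have lpa : phi a < l by rewrite -kap_gt0 kap_phi.
right; exists (Ordinal lpa), (Ordinal lb); split=> //; first by rewrite /= kb kap_phi.
move=> r frb; apply: val_inj => /=; case: (leqP r i) => ri.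
  by have := f_below _ ri; rewrite frb /=; lia.
move: frb; rewrite fgt //= => prb.
by case: (ltngtP r b) => // /phi_mono; rewrite prb ltnn.
Qed.

Lemma catalan_raise_rows e : catalan (row_roots l d) gamma e = catalan (row_roots l phi) gamma e.
Proof.
have raise i : i < l ->
    catalan (row_roots l [eta partial i with i |-> d i]) gamma e
    = catalan (row_roots l [eta partial i with i |-> phi i]) gamma e.
  move=> il.
  apply: (eq_of_steps (C := fun j => catalan (row_roots l [eta partial i with i |-> j]) gamma e)).
    exact: d_phi.
  move=> j /andP[dj jphi].
  have [lj|jl] := leqP l j.
    apply: eq_catalan_row => r c rl cl /=.
    by case: eqP => // _; lia.
  pose i' := Ordinal il; pose j' := Ordinal jl.
  have fi : [eta partial i with i |-> nat_of_ord j'] i' = j' by rewrite /= eqxx.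
  transitivity (catalan (row_roots l [eta partial i with i |-> nat_of_ord j']) gamma e).
    by apply: eq_catalan_row.
  rewrite (catalan_row_remove gamma e fi).
  rewrite (@eq_row_roots l _ [eta partial i with i |-> j.+1]); last first.
    by move=> r c rl cl /=; case: eqP.
  case: e => [|e']; first exact: addr0.
  have -> := @catalan_raised_root i i' j' e' (erefl _) _; first exact: addr0.
  by rewrite dj.
symmetry.
rewrite -(@eq_catalan_row l (partial 0) phi); last by [].
rewrite -(@eq_catalan_row l (partial l) d); last first.
  by move=> r c rl cl; rewrite /partial rl.
apply: (eq_of_steps (C := fun n => catalan (row_roots l (partial n)) gamma e)).
  exact: leq0n.
move=> n /andP[_ nl].
rewrite (@eq_catalan_row l (partial n) [eta partial n with n |-> phi n]); last first.
  by move=> r c rl cl /=; case: eqP => // ->; rewrite partialT.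
rewrite -(raise n nl); apply: eq_catalan_row => r c rl cl /=.
by rewrite /partial ltnS; case: (ltngtP r n) => [||->].
Qed.

End RaisingRows.

(** * Rows, columns and hooks of partitions *)

Lemma count_iota_between E K a n :
  count (fun r => E <= r < K) (iota a n) = minn K (a + n) - maxn E a.
Proof. by elim: n a => [|n IHn] a /=; rewrite ?IHn; lia. Qed.

Lemma part_nth_anti s : is_part s -> {homo nth 0 s : i j / i <= j >-> j <= i}.
Proof.
case/andP => s_sorted _ i j ij; have [js|sj] := ltnP j (size s); last by rewrite nth_default.
have geq_trans : transitive geq by move=> y x z xy yz; apply: leq_trans yz xy.
apply: (sorted_leq_nth geq_trans leqnn 0 s_sorted) => //.
by rewrite inE (leq_ltn_trans ij).
Qed.

Lemma part_nth_gt0 s i : is_part s -> (0 < nth 0 s i) = (i < size s).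
Proof.
case/andP => _ s0; have [js|sj] := ltnP i (size s); last by rewrite nth_default.
by rewrite lt0n; apply: contraNneq s0 => <-; rewrite mem_nth.
Qed.

Lemma part_col s c : is_part s ->
  exists2 K, K <= size s & forall r, box s r c = (r < K).
Proof.
move=> s_part; exists (find (geq c) s); first exact: find_size.
move=> r; rewrite /box; apply/idP/idP; last first.
  by move=> /(before_find 0) /= ; rewrite ltnNge => ->.
apply: contraTT; rewrite -!leqNgt => fr.
have [hs|] := boolP (has (geq c) s).
  by apply: leq_trans (part_nth_anti s_part fr) (nth_find 0 hs).
by move/hasNfind => fs; rewrite nth_default // -fs.
Qed.

Lemma hook_col s r c K : K <= size s -> (forall r', box s r' c = (r' < K)) ->
  hook s r c = (K - r.+1) + (nth 0 s r - c).
Proof.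
move=> Ks KE; rewrite /hook (eq_count (a2 := fun r' => 0 <= r' < K)) //.
by rewrite count_iota_between; congr (_ + _); lia.
Qed.

(** * Row starts of the two root sets attached to a core *)

Section CoreRows.
Variables (k : nat) (kappa eta : seq nat).
Hypotheses (core : is_core k.+1 kappa) (skew : is_k_skew k kappa eta)
  (lam_Par : Par k (bounded_part k kappa)).

Let lam := bounded_part k kappa.
(** The subtraction never truncates, by [bounded_le]. *)
Definition bounce i := i + k.+1 - nth 0 lam i.

Let kap_part : is_part kappa. Proof. by case: core. Qed.
Let eta_part : is_part eta. Proof. by case: skew. Qed.
Let lam_part : is_part lam. Proof. by case/andP: lam_Par. Qed.

Lemma skew_sub i : nth 0 eta i <= nth 0 kappa i.
Proof.
case: skew => _ sub _; rewrite leqNgt; apply/negP => /sub.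
by rewrite /box ltnn.
Qed.

Lemma size_bounded_part : size lam = size kappa.
Proof. by rewrite size_map size_iota. Qed.

Lemma skew_row i : nth 0 kappa i = nth 0 lam i + nth 0 eta i.
Proof.
have [il|li] := ltnP i (size kappa); last first.
  have := skew_sub i; rewrite (nth_default 0 li) leqn0 => /eqP ->.
  by rewrite nth_default ?size_bounded_part.
rewrite (nth_map 0) ?size_iota // nth_iota // add0n.
rewrite (eq_in_count (a2 := fun c => nth 0 eta i <= c < nth 0 kappa i)).
  by rewrite count_iota_between; have := skew_sub i; lia.
move=> c; rewrite mem_iota add0n => /= ci; rewrite ci andbT.
by case: skew => _ _ /(_ i c); rewrite /skew_box /box ci /= -leqNgt.
Qed.

Lemma bounded_le i : nth 0 lam i <= k.
Proof.
case/andP: lam_Par => _ /all_nthP le_k; have [il|li] := ltnP i (size lam); first exact: le_k.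
by rewrite nth_default.
Qed.

(* The hook of the last box of [eta] in row [i] exceeds [k + 1] and that of the
   next box is at most [k]: so the column just right of [eta_i] ends above row
   [bounce i] while column [eta_i] reaches it. *)
Lemma core_bounce i : nth 0 kappa (bounce i) = nth 0 eta i.
Proof.
rewrite /bounce; have lk := bounded_le i; have kE := skew_row i.
have [il|li] := ltnP i (size kappa); last first.
  rewrite (nth_default 0 li) in kE.
  rewrite nth_default; lia.
have l0 : 0 < nth 0 lam i by rewrite part_nth_gt0 // size_bounded_part.
case: skew => _ _ skewE; apply/eqP; rewrite eqn_leq; apply/andP; split.
  have [K Ks KE] := part_col (nth 0 eta i) kap_part.
  have KEd : (nth 0 eta i < nth 0 kappa (i + k.+1 - nth 0 lam i)) = _ := KE _.
  have ibox : box kappa i (nth 0 eta i) by rewrite /box kE; lia.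
  rewrite leqNgt KEd; have := skewE i (nth 0 eta i).
  by rewrite /skew_box ibox [box eta _ _]ltnn (hook_col _ Ks KE) /=; lia.
case: (posnP (nth 0 eta i)) => [->//|e0].
have [K Ks KE] := part_col (nth 0 eta i).-1 kap_part.
have ibox : box kappa i (nth 0 eta i).-1 by rewrite /box kE; lia.
have ebox : box eta i (nth 0 eta i).-1 by rewrite /box; lia.
have := skewE i (nth 0 eta i).-1; have := core.2 _ _ ibox.
rewrite /skew_box ibox ebox (hook_col _ Ks KE) /= => hk /esym/negbT.
have iK : i < K by rewrite -KE.
have KEd : ((nth 0 eta i).-1 < nth 0 kappa (i + k.+1 - nth 0 lam i)) = _ := KE _.
by rewrite -ltnNge => hk'; move: KEd; lia.
Qed.

(* In the rows with [eta_i = 0] both root sets are empty; taking [bounce] there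
   keeps the row starts strictly increasing. *)
Definition skew_start i :=
  if 0 < nth 0 eta i then col_size kappa eta (nth 0 eta i).-1 + i else bounce i.

(** For eta_i > 0, let K and E be the lengths of column eta_i in kappa and in eta; the start is K -
    E + i. Row E-1 bounces to a row above K, and [bounce] grows by at least one per row, so bounce i
    <= K - E + i < K. This squeezes the length of the row at the start between eta_i and
    kappa_(bounce i) = eta_i. *)
Lemma skew_start_spec i : bounce i <= skew_start i /\ nth 0 kappa (skew_start i) = nth 0 eta i.
Proof.
rewrite /skew_start; case: (posnP (nth 0 eta i)) => [e0|e0]; first by rewrite core_bounce.
set c := (nth 0 eta i).-1.
have [K Ks KE] := part_col c kap_part; have [E Es EE] := part_col c eta_part.
have KE' r : (nth 0 eta i <= nth 0 kappa r) = (r < K) by rewrite -KE /box /c prednK.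
have EE' r : (nth 0 eta i <= nth 0 eta r) = (r < E) by rewrite -EE /box /c prednK.
have iE : i < E by rewrite -EE'.
have EK : E <= K.
  by case: (E) EE' => // e EE'; rewrite -KE' (leq_trans _ (skew_sub e)) // EE'.
have -> : col_size kappa eta c = K - E.
  rewrite /col_size (eq_count (a2 := fun r => E <= r < K)); last first.
    by move=> r; rewrite /= /skew_box KE EE -leqNgt andbC.
  by rewrite count_iota_between; lia.
have lastE : bounce E.-1 < K by rewrite -KE' core_bounce EE' prednK // (leq_ltn_trans _ iE).
have bE : bounce i <= K - E + i.
  have := part_nth_anti lam_part (_ : i <= E.-1); have := bounded_le i.
  by move: lastE; rewrite /bounce => b1 b2 /(_ ltac:(lia)); lia.
split=> //; apply/eqP; rewrite eqn_leq KE' -(core_bounce i) part_nth_anti //=.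
by lia.
Qed.

Lemma bounce_mono : {homo bounce : i j / i < j}.
Proof.
move=> i j ij; have := part_nth_anti lam_part (ltnW ij); have := bounded_le i.
by rewrite /bounce; lia.
Qed.

Lemma skew_startS i : 0 < nth 0 eta i -> nth 0 eta i.+1 = nth 0 eta i ->
  skew_start i.+1 = (skew_start i).+1.
Proof. by move=> e0 e1; rewrite /skew_start e1 e0 addnS. Qed.

(** Where eta drops strictly, so does the length of the kappa-row at the start, which forces the
    start to grow. *)
Lemma skew_start_mono : {homo skew_start : i j / i < j}.
Proof.
apply: homo_ltn => [j i k' | i]; first exact: ltn_trans.
have := part_nth_anti eta_part (leqnSn i).
rewrite leq_eqVlt => /orP[/eqP e1|e1].
  have [e0|e0] := posnP (nth 0 eta i); last by rewrite skew_startS.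
  by rewrite /skew_start e1 e0 /=; apply: bounce_mono.
rewrite ltnNge; apply/negP => /(part_nth_anti kap_part).
by have [_ ->] := skew_start_spec i; have [_ ->] := skew_start_spec i.+1; rewrite leqNgt e1.
Qed.

End CoreRows.

Theorem theorem10p4 (k : nat) (lambda kappa eta : seq nat) :
  0 < k ->
  Par k lambda ->
  is_core k.+1 kappa -> bounded_part k kappa = lambda ->
  is_k_skew k kappa eta ->
  catalan (Delta_k k (weight (size kappa) lambda)) (weight (size kappa) lambda)
  =1 catalan (Phi kappa eta) (weight (size kappa) lambda).
Proof.
move=> _ lam_Par core lamE skew e; subst lambda.
set lam := bounded_part k kappa in lam_Par *.
have lam_part : is_part lam by case/andP: lam_Par.
have kap_part : is_part kappa by case: core.
have eta_part : is_part eta by case: skew.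
have start_spec := skew_start_spec core skew lam_Par.
have lam_le := bounded_le lam_Par.
have -> : Delta_k k (weight (size kappa) lam) = row_roots (size kappa) (bounce k kappa).
  apply/setP => -[i j]; rewrite !inE /= /weight !mxE /bounce -/lam.
  by have := lam_le i; rewrite -/lam; lia.
have -> : Phi kappa eta = row_roots (size kappa) (skew_start k kappa eta).
  apply/setP => -[i j]; rewrite !inE /= -(part_nth_gt0 i eta_part).
  have [] := start_spec i; rewrite /skew_start.
  have [e0|e0] := posnP (nth 0 eta i).
    (* Here eta_i = 0, so row [bounce] of kappa is empty and the start lies beyond the last
       column. *)
    rewrite andbF => _ kap0; have bl : (bounce k kappa i < size kappa) = false.
      by rewrite -part_nth_gt0 // kap0 e0.
    by apply/esym/negbTE; rewrite -ltnNge (leq_trans (ltn_ord j)) // leqNgt bl.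
  move=> le_start _; apply: andb_idl => start_j.
  apply: leq_trans start_j; apply: leq_trans le_start.
  by rewrite /bounce; have := lam_le i; rewrite -/lam; lia.
apply: (@catalan_raise_rows (size kappa) (nth 0 kappa) (nth 0 lam) (nth 0 eta)).
- exact: part_nth_anti.
- exact: part_nth_anti.
- exact: (skew_row core skew lam_Par).
- by move=> i; rewrite -(size_bounded_part k kappa); exact: part_nth_gt0.
- by move=> i; exact: part_nth_gt0.
- by move=> i; rewrite /bounce; have := lam_le i; rewrite -/lam; lia.
- exact: (bounce_mono core skew lam_Par).
- exact: (core_bounce core skew lam_Par).
- by move=> i; have [] := start_spec i.
- by move=> i; have [] := start_spec i.
- exact: (skew_start_mono core skew lam_Par).
- exact: skew_startS.
by move=> i; rewrite mxE.
Qed.
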